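(* Let $V_0$ be a real reflexive Banach space, $A:V_0\times V_0\to\mathbb R$ a symmetric bilinear form, $L:V_0\to\mathbb R$ a linear functional, and $J_\theta:V_0\to\mathbb R$ a Gâteaux differentiable functional whose differential $J'_\theta({\bf u},{\bf v})$ is linear in ${\bf v}$ (possibly nonlinear in ${\bf u}$). Suppose there are constants $M,B,T,D>0$ such that for all ${\bf u},{\bf v},{\bf w}\in V_0$ $$|A({\bf u},{\bf v})|\le M\|{\bf u}\|_{V_0}\|{\bf v}\|_{V_0},\quad A({\bf u},{\bf u})\ge B\|{\bf u}\|_{V_0}^2,\quad |L({\bf v})|\le T\|{\bf v}\|_{V_0},$$ $$J'_\theta({\bf u}+{\bf v},{\bf v})-J'_\theta({\bf u},{\bf v})\ge0,\qquad |J'_\theta({\bf u}+{\bf w},{\bf v})-J'_\theta({\bf u},{\bf v})|\le D\|{\bf v}\|_{V_0}\|{\bf w}\|_{V_0},$$ and for every ${\bf u}\in V_0$ there is $\tilde R>0$ with $|J'_\theta({\bf u},{\bf v})|\le\tilde R\|{\bf v}\|_{V_0}$ for all ${\bf v}\in V_0$. Let $G:V_0\times V_0\to\mathbb R$ be a symmetric bilinear form with constants $\tilde M,\tilde B>0$ such that for all ${\bf u},{\bf v}\in V_0$ $$|G({\bf u},{\bf v})|\le\tilde M\|{\bf u}\|_{V_0}\|{\bf v}\|_{V_0},\qquad G({\bf u},{\bf u})\ge\tilde B\|{\bf u}\|_{V_0}^2 .$$ Put $M_*=M+D$ and let $\gamma\in(0;\gamma_2)$, $\gamma_2=2B\tilde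 B/M_*^2$. Let $\bar{\bf u}\in V_0$ be the exact solution of $A(\bar{\bf u},{\bf v})+J'_\theta(\bar{\bf u},{\bf v})-L({\bf v})=0$ for all ${\bf v}\in V_0$. Then, for any ${\bf u}^0\in V_0$, the sequence $\{{\bf u}^k\}\subset V_0$ obtained by $$G({\bf u}^{k+1},{\bf v})=G({\bf u}^k,{\bf v})-\gamma\big[A({\bf u}^k,{\bf v})+J'_\theta({\bf u}^k,{\bf v})-L({\bf v})\big]\quad\forall\,{\bf v}\in V_0,\ k=0,1,\dots$$ converges strongly in $V_0$ to $\bar{\bf u}$, i.e. $\|{\bf u}^k-\bar{\bf u}\|_{V_0}\to0$ as $k\to\infty$, and the convergence rate in the energy norm $\|{\bf u}\|_G=\sqrt{G({\bf u},{\bf u})}$ is linear: $$\|{\bf u}^{k+1}-\bar{\bf u}\|_G\le q\,\|{\bf u}^k-\bar{\bf u}\|_G,\qquad q=\sqrt{1-\gamma\big(2B-\gamma M_*^2/\tilde B\big)/\tilde M}<1 .$$ Moreover, the maximal convergence rate (i.e. the minimal value of $q$ as a function of $\gamma\in(0;\gamma_2)$) is reached at $\gamma=\bar\gamma=B\tilde B/M_*^2$.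
   Context: Under the stated hypotheses on $A$, $L$, $J_\theta$, the variational equation $A({\bf u},{\bf v})+J'_\theta({\bf u},{\bf v})-L({\bf v})=0$ for all ${\bf v}\in V_0$ (the Euler equation for minimizing $\frac12A({\bf u},{\bf u})-L({\bf u})+J_\theta({\bf u})$ over $V_0$) has a unique solution in $V_0$, called the exact solution. *)

(* Defs.v *)
From HB Require Import structures.
From mathcomp Require Import all_boot all_order all_algebra.
From mathcomp Require Import all_classical all_reals all_analysis.
Import Order.TTheory GRing.Theory Num.Theory.
Import numFieldNormedType.Exports.

Set Implicit Arguments.
Unset Strict Implicit.
Unset Printing Implicit Defensive.

Local Open Scope classical_set_scope.
Local Open Scope ring_scope.

Definition dual (R : realType) (V : normedModType R) : set (V -> R^o) :=
  [set f : V -> R^o | scalar f /\ continuous f].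

Definition dual_norm (R : realType) (V : normedModType R) (f : V -> R^o) : R :=
  sup [set `|f x| | x in [set x : V | `|x| <= 1]].

(* The elements of the bidual are represented by functions Phi on V -> R^o of
   which only the values on [dual V] matter; reflexivity is the surjectivity
   of the canonical embedding x |-> (f |-> f x) of V into its bidual. *)
Definition bidual (R : realType) (V : normedModType R) :
    set ((V -> R^o) -> R) :=
  [set Phi | (forall (a : R) (f g : V -> R^o), dual f -> dual g ->
                Phi (a *: f + g) = a * Phi f + Phi g) /\
             (exists C : R, forall f : V -> R^o, dual f ->
                `|Phi f| <= C * dual_norm f)].

Definition reflexive_space (R : realType) (V : normedModType R) : Prop :=
  forall Phi : (V -> R^o) -> R, bidual Phi ->
    exists x : V, forall f : V -> R^o, dual f -> Phi f = f x.

(* Directional derivatives exist everywhere and the differential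
   J'(u, v) = 'D_v J u is linear in v; its boundedness in v is not included. *)
Definition gateaux_differentiable (R : realType) (V : normedModType R)
    (J : V -> R^o) : Prop :=
  (forall u v : V, derivable J u v) /\
  (forall u : V, scalar (fun v : V => 'D_v J u)).

Definition residual (R : realType) (V : normedModType R) (A : {biscalar V})
    (J : V -> R^o) (L : {scalar V}) (u v : V) : R :=
  A u v + 'D_v J u - L v.

Definition exact_solution (R : realType) (V : normedModType R)
    (A : {biscalar V}) (J : V -> R^o) (L : {scalar V}) (u : V) : Prop :=
  forall v : V, residual A J L u v = 0.

Definition iteration (R : realType) (V : normedModType R)
    (G A : {biscalar V}) (J : V -> R^o) (L : {scalar V}) (gamma : R) (u0 : V)
    (u : nat -> V) : Prop :=
  u 0%N = u0 /\
  forall (k : nat) (v : V),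
    G (u k.+1) v = G (u k) v - gamma * residual A J L (u k) v.

Definition energy_norm (R : realType) (V : normedModType R)
    (G : {biscalar V}) (u : V) : R := Num.sqrt (G u u).

Definition rate (R : realType) (B Mstar Mt Bt gamma : R) : R :=
  Num.sqrt (1 - gamma * (2 * B - gamma * Mstar ^+ 2 / Bt) / Mt).

(* Main.v *)
Require Import Defs.
From HB Require Import structures.
From mathcomp Require Import all_boot all_order all_algebra.
From mathcomp Require Import all_classical all_reals all_analysis.
Import Order.TTheory GRing.Theory Num.Theory.
Import numFieldNormedType.Exports.
From mathcomp Require Import ring lra.

Local Open Scope classical_set_scope.
Local Open Scope ring_scope.

Set Implicit Arguments.
Unset Strict Implicit.
Unset Printing Implicit Defensive.

(** The form G is an inner product whose norm is equivalent to that of the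
complete space, so every bounded linear functional F is G(w, .) for exactly
one w (riesz_representation). Since the residual
r_u(v) = A(u, v) + J'(u, v) - L(v) is linear and bounded in v, each step of
the scheme has exactly one solution, hence so does the whole recursion.

The residual, as an operator of u, is strongly monotone with constant B
(coercivity of A and monotonicity of J') and Lipschitz with constant
M* = M + D, and it vanishes at the exact solution. Put e = u^k - ubar and
d = u^{k+1} - u^k, so that G(d, v) = - gamma r(v) with r(e) >= B |e|^2 and
|r(v)| <= M* |e| |v|. In
  G(e + d, e + d) = G(e, e) - 2 gamma r(e) + G(d, d)
the cross term decreases the energy by at least 2 gamma B |e|^2, whereas
Bt |d|^2 <= G(d, d) <= gamma M* |e| |d| gives
G(d, d) <= gamma^2 M*^2 |e|^2 / Bt. For gamma < gamma_2 the net gain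
gamma (2 B - gamma M*^2 / Bt) |e|^2 is positive, and G(e, e) <= Mt |e|^2
turns it into a fraction of G(e, e): this is the factor q
(energy_step_le). Geometric decay of the energy norm, which dominates
sqrt(Bt) |.|, yields strong convergence. Finally the radicand of q is a convex
parabola in gamma, with vertex B Bt / M*^2 (rate_minimal). *)

(** * Riesz representation for a coercive symmetric form *)

Section minimization.
Variables (R : realType) (V : normedModType R).
Variables (G : {biscalar V}) (F : {scalar V}).
Hypothesis G_sym : forall u v : V, G u v = G v u.

(** A critical point w of this functional satisfies G w v = F v for all v. *)
Definition riesz_functional (w : V) : R := G w w - 2 * F w.

Lemma rieszDZ (w v : V) (t : R) :
  riesz_functional (w + t *: v) =
  riesz_functional w + 2 * t * (G w v - F v) + t ^+ 2 * G v v.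
Proof.
have Zl z : G (t *: v) z = t * G v z by exact: linearZl_LR.
have Zr z : G z (t *: v) = t * G z v by exact: linearZr_LR.
have FZ : F (t *: v) = t * F v by exact: linearZ_LR.
rewrite /riesz_functional linearDl !linearDr linearD !(Zl, Zr, FZ) (G_sym v w).
by rewrite /=; ring.
Qed.

(** The point w' + (w - w') / 2 is the midpoint of w and w'. As its value is at
least the infimum, near-minimisers are close to each other in the G-norm. *)
Lemma riesz_parallelogram (w w' : V) :
  G (w - w') (w - w') =
  2 * riesz_functional w + 2 * riesz_functional w' -
  4 * riesz_functional (w' + 2^-1 *: (w - w')).
Proof.
rewrite rieszDZ /riesz_functional !linearBl !linearBr /= (G_sym w' w) linearB.
by rewrite /=; field.
Qed.

Lemma riesz_bounded_below (B C : R) : 0 < B ->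
    (forall u, B * `|u| ^+ 2 <= G u u) -> (forall v, `|F v| <= C * `|v|) ->
  forall w, - (C ^+ 2 / B) <= riesz_functional w.
Proof.
move=> B0 Gc Fb w; rewrite /riesz_functional.
have FwC : F w <= C * `|w| by apply: le_trans (Fb w); apply: ler_norm.
(* Completing the square in B |w|^2 - 2 C |w|. *)
have H : 0 <= B * (`|w| - C / B) ^+ 2 by rewrite mulr_ge0 ?sqr_ge0 // ltW.
have E : B * (`|w| - C / B) ^+ 2 = B * `|w| ^+ 2 - 2 * (C * `|w|) + C ^+ 2 / B.
  by field; rewrite gt_eqF.
have := Gc w; lra.
Qed.
End minimization.

(** The discriminant criterion, with a bound c of the leading coefficient b in
its place: the value t = - a / c is admissible even when b = 0. Along a line
through an eps-minimiser of the Riesz functional, it bounds the slope a. *)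
Lemma quadratic_gt0_bound (R : realFieldType) (eps a b c : R) :
    0 < c -> b <= c ->
    (forall t : R, 0 < eps + 2 * t * a + t ^+ 2 * b) ->
  a ^+ 2 <= eps * c.
Proof.
move=> c0 bc /(_ (- (a / c))) h.
have : 0 < eps - a ^+ 2 / c.
  apply: lt_le_trans h _.
  have -> : eps - a ^+ 2 / c = eps + 2 * - (a / c) * a + (- (a / c)) ^+ 2 * c.
    by field; rewrite gt_eqF.
  by rewrite lerD2l ler_wpM2l // sqr_ge0.
by rewrite subr_gt0 ltr_pdivrMr // => /ltW.
Qed.

(** A minimising sequence of the Riesz functional is Cauchy by the parallelogram
identity. Its limit represents F because the slope at an eps-minimiser is
O(sqrt eps) in each direction and G(., v) is continuous. *)
Lemma riesz_representation (R : realType) (V : completeNormedModType R)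
    (G : {biscalar V}) (F : {scalar V}) (M B C : R) :
    0 < M -> 0 < B -> (forall u v : V, G u v = G v u) ->
    (forall u v : V, `|G u v| <= M * `|u| * `|v|) ->
    (forall u : V, B * `|u| ^+ 2 <= G u u) ->
    (forall v : V, `|F v| <= C * `|v|) ->
  exists w : V, forall v : V, G w v = F v.
Proof.
move=> M0 B0 Gs Gb Gc Fb.
pose E := [set riesz_functional G F w | w in [set: V]].
have Elb : has_lbound E.
  exists (- (C ^+ 2 / B)) => _ [w _ <-].
  exact: riesz_bounded_below.
have E0 : E !=set0 by exists (riesz_functional G F 0); exists 0.
have infE w : inf E <= riesz_functional G F w by apply: ge_inf => //; exists w.
have /choice[u uE] : forall n : nat, exists w,
    riesz_functional G F w < inf E + n.+1%:R^-1.
  move=> n.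
  have n0 : 0 < n.+1%:R^-1 :> R by rewrite invr_gt0.
  by have [_ [w _ <-] ?] := inf_adherent n0 (conj E0 Elb); exists w.
have ucauchy : cauchy (u @ \oo).
  apply: cauchy_exP => e e0.
  have d0 : 0 < B * e ^+ 2 / 4 by rewrite divr_gt0 // mulr_gt0 // exprn_gt0.
  have [N _ HN] := near_infty_natSinv_lt (PosNum d0).
  exists (u N); exists N => // n /= Nn; rewrite -ball_normE /=.
  have Gle : G (u N - u n) (u N - u n) < B * e ^+ 2.
    rewrite (riesz_parallelogram F Gs).
    have := infE (u n + 2^-1 *: (u N - u n)).
    have := uE N; have := uE n.
    have dN : N.+1%:R^-1 < B * e ^+ 2 / 4 := HN N (leqnn N).
    have dn : n.+1%:R^-1 < B * e ^+ 2 / 4 := HN n Nn.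
    move: (N.+1%:R^-1) (n.+1%:R^-1) dN dn => a b; lra.
  have := le_lt_trans (Gc _) Gle.
  by rewrite ltr_pM2l // ltr_pXn2r ?nnegrE // ltW.
have /cvg_ex[w uw] : cvg (u @ \oo) by exact: cauchy_cvg.
exists w => v.
(* The summand 1 keeps the bound of G v v positive when v = 0. *)
have c0 : 0 < M * `|v| * `|v| + 1 by rewrite ltr_pwDr // !mulr_ge0 // ltW.
have GuF : (fun n => G (u n) v : R^o) @ \oo --> (F v : R^o).
  apply/cvgrPdist_lt => e e0.
  have d0 : 0 < e ^+ 2 / (M * `|v| * `|v| + 1) by rewrite divr_gt0 // exprn_gt0.
  near=> n.
  have an : (G (u n) v - F v) ^+ 2 <= n.+1%:R^-1 * (M * `|v| * `|v| + 1).
    apply: (@quadratic_gt0_bound _ _ _ (G v v)) => //.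
      by rewrite ler_wpDr // (le_trans (ler_norm _)).
    move=> t; have := infE (u n + t *: v); rewrite (rieszDZ F Gs).
    have := uE n; move: n.+1%:R^-1 => d; lra.
  rewrite distrC -(@ltr_pXn2r _ 2) ?nnegrE ?(ltW e0) // real_normK ?num_real //.
  apply: le_lt_trans an _; rewrite -ltr_pdivlMr //.
  by near: n; exact: (near_infty_natSinv_lt (PosNum d0)).
have Guw : (fun n => G (u n) v : R^o) @ \oo --> (G w v : R^o).
  apply/cvgrPdist_lt => e e0.
  have k0 : 0 < M * `|v| + 1 by rewrite ltr_pwDr // mulr_ge0 // ltW.
  have d0 : 0 < e / (M * `|v| + 1) by rewrite divr_gt0.
  near=> n.
  rewrite -linearBl /=; apply: le_lt_trans (Gb _ _) _.
  rewrite mulrAC; apply: (@le_lt_trans _ _ ((M * `|v| + 1) * `|w - u n|)).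
    by rewrite ler_wpM2r // lerDl.
  rewrite mulrC -ltr_pdivlMr //.
  by near: n; move/cvgrPdist_lt : uw; apply.
exact: (cvg_unique _ Guw GuF).
Unshelve. all: by end_near.
Qed.

(** * Contraction in the energy norm *)

Section coercive_form.
Variables (R : realType) (V : normedModType R) (G : {biscalar V}).
Variables (B : R).
Hypothesis B_gt0 : 0 < B.
Hypothesis G_coercive : forall u : V, B * `|u| ^+ 2 <= G u u.

Lemma coercive_ge0 (u : V) : 0 <= G u u.
Proof. by apply: le_trans (G_coercive u); rewrite mulr_ge0 ?sqr_ge0 // ltW. Qed.

Lemma coercive_inj (u w : V) : (forall v, G u v = G w v) -> u = w.
Proof.
move=> uw; apply/eqP; rewrite -subr_eq0 -normr_eq0 -sqrf_eq0 eq_le sqr_ge0.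
by have := G_coercive (u - w); rewrite linearBl uw subrr pmulr_rle0 // => ->.
Qed.

Lemma le_energy_norm (u : V) : Num.sqrt B * `|u| <= energy_norm G u.
Proof.
rewrite -[`|u|]ger0_norm // -sqrtr_sqr -sqrtrM ?(ltW B_gt0) //.
exact: ler_wsqrtr.
Qed.

Lemma energy_norm_contraction_cvg (u : nat -> V) (a : V) (q : R) :
    0 <= q < 1 ->
    (forall k, energy_norm G (u k.+1 - a) <= q * energy_norm G (u k - a)) ->
  u @ \oo --> a.
Proof.
move=> /andP[q0 q1] uq.
have geo k : energy_norm G (u k - a) <= energy_norm G (u 0%N - a) * q ^+ k.
  elim: k => [|k IH]; first by rewrite expr0 mulr1.
  by apply: le_trans (uq k) _; rewrite exprS mulrCA ler_wpM2l.
have sB : 0 < Num.sqrt B by rewrite sqrtr_gt0.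
apply/subr_cvg0/norm_cvg0P.
pose c := energy_norm G (u 0%N - a) / Num.sqrt B.
apply: (@squeeze_cvgr _ _ _ _ (cst 0) (geometric c q)); last first.
- by apply: cvg_geometric; rewrite ger0_norm.
- exact: cvg_cst.
apply: nearW => k; rewrite normr_ge0 /= /c mulrAC ler_pdivlMr // mulrC.
exact: le_trans (le_energy_norm _) (geo k).
Qed.

(** One step in the direction d, which is - gamma times the G-gradient of r.
The bound on r at d together with coercivity controls G d d from above by a
multiple of |e|^2, and the bound on r at e controls the cross term
2 G e d = - 2 gamma r e. *)
Lemma energy_step_le (M K gamma : R) (e d : V) (r : V -> R) :
    0 < M -> 0 <= gamma ->
    (forall u v : V, G u v = G v u) ->
    (forall u v : V, `|G u v| <= M * `|u| * `|v|) ->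
    (forall v, G d v = - (gamma * r v)) ->
    (forall v, `|r v| <= K * `|e| * `|v|) ->
  forall b, b * `|e| ^+ 2 <= r e ->
    0 <= gamma * (2 * b - gamma * K ^+ 2 / B) ->
  G (e + d) (e + d) <= (1 - gamma * (2 * b - gamma * K ^+ 2 / B) / M) * G e e.
Proof.
move=> M0 g0 Gs Gb Gd rb b re.
set s := 2 * b - _ => gs0.
have GddE : G (e + d) (e + d) = G e e - 2 * gamma * r e + G d d.
  by rewrite linearDl !linearDr (Gs e d) Gd /=; ring.
pose t := gamma * K * `|e|.
have Gdt : G d d <= t * `|d|.
  rewrite Gd -mulrN /t -!mulrA ler_wpM2l // mulrA.
  by apply: le_trans (rb d); rewrite -normrN ler_norm.
(* From B |d|^2 <= t |d| and 2 t |d| <= t^2 / B + B |d|^2, without dividing by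
   |d|, which may vanish. *)
have td : t * `|d| <= t ^+ 2 / B.
  have := le_trans (G_coercive d) Gdt.
  have H : 0 <= B * (t / B - `|d|) ^+ 2 by rewrite mulr_ge0 ?sqr_ge0 // ltW.
  have E : B * (t / B - `|d|) ^+ 2 =
      t ^+ 2 / B - 2 * (t * `|d|) + B * `|d| ^+ 2.
    by field; rewrite gt_eqF.
  lra.
have step : G (e + d) (e + d) <= G e e - gamma * s * `|e| ^+ 2.
  have E : gamma * s * `|e| ^+ 2 = 2 * (gamma * (b * `|e| ^+ 2)) - t ^+ 2 / B.
    by rewrite /s /t; field; rewrite gt_eqF.
  have := ler_wpM2l g0 re; lra.
apply: le_trans step _.
rewrite mulrBl mul1r lerD2l lerN2 mulrAC -mulrA ler_wpM2l //.
rewrite ler_pdivrMr // mulrC expr2 mulrA.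
by apply: le_trans (Gb e e); exact: ler_norm.
Qed.
End coercive_form.

(** * The residual operator and the iteration *)

Section residual.
Variables (R : realType) (V : normedModType R).
Variables (A : {biscalar V}) (J : V -> R^o) (L : {scalar V}).
Hypothesis J_diff : gateaux_differentiable J.

Lemma residual_scalar (u : V) : scalar (residual A J L u).
Proof.
move=> a v w; rewrite /residual linearPr linearP (J_diff.2 u a v w) /=; ring.
Qed.

Variables (M B T D : R).
Hypothesis A_bounded : forall u v : V, `|A u v| <= M * `|u| * `|v|.
Hypothesis L_bounded : forall v : V, `|L v| <= T * `|v|.
Hypothesis J_bounded : forall u : V, exists Rt : R,
  0 < Rt /\ forall v : V, `|'D_v J u| <= Rt * `|v|.

Lemma residual_bounded (u : V) :
  exists C : R, forall v, `|residual A J L u v| <= C * `|v|.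
Proof.
have [Rt [_ Jb]] := J_bounded u; exists (M * `|u| + Rt + T) => v.
rewrite !mulrDl (le_trans (ler_normB _ _)) // lerD //.
by rewrite (le_trans (ler_normD _ _)) // lerD.
Qed.

Hypothesis J_lipschitz : forall u v w : V,
  `|'D_v J (u + w) - 'D_v J u| <= D * `|v| * `|w|.

Lemma residual_lipschitz (u w v : V) :
  `|residual A J L u v - residual A J L w v| <= (M + D) * `|u - w| * `|v|.
Proof.
have -> : residual A J L u v - residual A J L w v =
    A (u - w) v + ('D_v J u - 'D_v J w).
  by rewrite /residual linearBl /=; ring.
rewrite (le_trans (ler_normD _ _)) // !mulrDl lerD //.
by have := J_lipschitz w v (u - w); rewrite subrKC mulrAC.
Qed.

Hypothesis A_coercive : forall u : V, B * `|u| ^+ 2 <= A u u.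
Hypothesis J_monotone : forall u v : V, 0 <= 'D_v J (u + v) - 'D_v J u.

Lemma residual_strongly_monotone (u w : V) :
  B * `|u - w| ^+ 2 <= residual A J L u (u - w) - residual A J L w (u - w).
Proof.
have -> : residual A J L u (u - w) - residual A J L w (u - w) =
    A (u - w) (u - w) + ('D_(u - w) J u - 'D_(u - w) J w).
  by rewrite /residual [A (u - w) _]linearBl /=; ring.
apply: ler_wpDr => //.
by have := J_monotone w (u - w); rewrite subrKC.
Qed.
End residual.

(** The next iterate represents the functional v |-> G u v - gamma r_u(v). *)
Lemma iteration_step_solvable (R : realType) (V : completeNormedModType R)
    (G A : {biscalar V}) (J : V -> R^o) (L : {scalar V}) (M T Mt Bt gamma : R) :
    0 < Mt -> 0 < Bt -> gateaux_differentiable J ->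
    (forall u v : V, `|A u v| <= M * `|u| * `|v|) ->
    (forall v : V, `|L v| <= T * `|v|) ->
    (forall u : V, exists Rt : R,
      0 < Rt /\ forall v : V, `|'D_v J u| <= Rt * `|v|) ->
    (forall u v : V, G u v = G v u) ->
    (forall u v : V, `|G u v| <= Mt * `|u| * `|v|) ->
    (forall u : V, Bt * `|u| ^+ 2 <= G u u) ->
  forall u : V, exists w : V, forall v : V,
    G w v = G u v - gamma * residual A J L u v.
Proof.
move=> Mt0 Bt0 Jd Ab Lb Jb Gs Gb Gc u.
pose f v : R := G u v - gamma * residual A J L u v.
have flin : scalar f.
  by move=> a v w; rewrite /f linearPr residual_scalar //=; ring.
pose F : {scalar V} := HB.pack f (GRing.isLinear.Build R V R *%R f flin).
have [C rC] := residual_bounded Ab Lb Jb u.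
apply: (@riesz_representation R V G F Mt Bt (Mt * `|u| + `|gamma| * C)) => //.
move=> v; rewrite mulrDl (le_trans (ler_normB _ _)) // lerD //.
by rewrite normrM -mulrA ler_wpM2l.
Qed.

Lemma iteration_exists_unique (R : realType) (V : normedModType R)
    (G A : {biscalar V}) (J : V -> R^o) (L : {scalar V}) (B gamma : R) :
    0 < B -> (forall u : V, B * `|u| ^+ 2 <= G u u) ->
    (forall u : V, exists w : V, forall v : V,
      G w v = G u v - gamma * residual A J L u v) ->
  forall u0, exists! u : nat -> V, iteration G A J L gamma u0 u.
Proof.
move=> B0 Gc /choice[next nextE] u0.
exists (fun k => iter k next u0); split; first by split=> // k v; rewrite iterS.
move=> w [w0 wE]; apply/funext; elim=> [|k IH]; first by rewrite w0.
by apply: (coercive_inj B0 Gc) => v; rewrite wE -IH iterS nextE.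
Qed.

(** * The rate as a function of the step *)

Section rate.
Variables (R : realType) (B K Mt Bt : R).
Hypotheses (B_gt0 : 0 < B) (K_gt0 : 0 < K) (Mt_gt0 : 0 < Mt) (Bt_gt0 : 0 < Bt).

Lemma rate_gain_gt0 (gamma : R) : 0 < gamma < 2 * B * Bt / K ^+ 2 ->
  0 < gamma * (2 * B - gamma * K ^+ 2 / Bt).
Proof.
move=> /andP[g0]; rewrite ltr_pdivlMr ?exprn_gt0 // => gK.
by rewrite mulr_gt0 // subr_gt0 ltr_pdivrMr.
Qed.

Lemma rate_lt1 (gamma : R) : 0 < gamma < 2 * B * Bt / K ^+ 2 ->
  rate B K Mt Bt gamma < 1.
Proof.
move=> /rate_gain_gt0 gain; rewrite /rate -[ltRHS]sqrtr1 ltr_sqrt //.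
by rewrite gtrDl oppr_lt0 divr_gt0.
Qed.

(** The gain gamma (2 B - gamma K^2 / Bt) falls short of its value at the vertex
by (K (gamma - B Bt / K^2))^2 / Bt. *)
Lemma rate_minimal (gamma : R) :
  rate B K Mt Bt (B * Bt / K ^+ 2) <= rate B K Mt Bt gamma.
Proof.
rewrite /rate; apply: ler_wsqrtr.
rewrite lerD2l lerN2 ler_wpM2r ?invr_ge0 ?(ltW Mt_gt0) //.
rewrite -subr_ge0.
have -> : B * Bt / K ^+ 2 * (2 * B - B * Bt / K ^+ 2 * K ^+ 2 / Bt) -
    gamma * (2 * B - gamma * K ^+ 2 / Bt) =
    (K * (gamma - B * Bt / K ^+ 2)) ^+ 2 / Bt.
  by field; rewrite !gt_eqF.
by rewrite divr_ge0 ?sqr_ge0 // ltW.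
Qed.
End rate.

Unset Implicit Arguments.

Theorem theorem4 (R : realType) (V0 : completeNormedModType R)
    (V0_reflexive : reflexive_space V0)
    (A : {biscalar V0}) (L : {scalar V0}) (J : V0 -> R^o) (G : {biscalar V0})
    (M B T D Mt Bt : R)
    (M_gt0 : 0 < M) (B_gt0 : 0 < B) (T_gt0 : 0 < T) (D_gt0 : 0 < D)
    (A_sym : forall u v : V0, A u v = A v u)
    (J_diff : gateaux_differentiable J)
    (A_bounded : forall u v : V0, `|A u v| <= M * `|u| * `|v|)
    (A_coercive : forall u : V0, B * `|u| ^+ 2 <= A u u)
    (L_bounded : forall v : V0, `|L v| <= T * `|v|)
    (J_monotone : forall u v : V0, 0 <= 'D_v J (u + v) - 'D_v J u)
    (J_lipschitz : forall u v w : V0,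
      `|'D_v J (u + w) - 'D_v J u| <= D * `|v| * `|w|)
    (J_bounded : forall u : V0, exists Rt : R,
      0 < Rt /\ forall v : V0, `|'D_v J u| <= Rt * `|v|)
    (Mt_gt0 : 0 < Mt) (Bt_gt0 : 0 < Bt)
    (G_sym : forall u v : V0, G u v = G v u)
    (G_bounded : forall u v : V0, `|G u v| <= Mt * `|u| * `|v|)
    (G_coercive : forall u : V0, Bt * `|u| ^+ 2 <= G u u)
    (ubar : V0) (ubar_exact : exact_solution A J L ubar) :
  let Mstar := M + D in
  let gamma2 := 2 * B * Bt / Mstar ^+ 2 in
  let q := rate B Mstar Mt Bt in
  let gammabar := B * Bt / Mstar ^+ 2 in
  (forall gamma : R, 0 < gamma < gamma2 ->
    q gamma < 1 /\
    forall u0 : V0,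
      (exists! u : nat -> V0, iteration G A J L gamma u0 u) /\
      (forall u : nat -> V0, iteration G A J L gamma u0 u ->
        u @ \oo --> ubar /\
        forall k : nat, energy_norm G (u k.+1 - ubar) <=
                        q gamma * energy_norm G (u k - ubar))) /\
  (0 < gammabar < gamma2 /\
   forall gamma : R, 0 < gamma < gamma2 -> q gammabar <= q gamma).
Proof.
move=> Mstar gamma2 q gammabar.
have Ms0 : 0 < Mstar by exact: addr_gt0.
split; last split=> [|gamma _]; last by apply: rate_minimal.
  move=> gamma gint; split; first exact: rate_lt1.
  have /andP[g0 _] := gint.
  move=> u0; split.
    apply: (iteration_exists_unique Bt_gt0 G_coercive).
    exact: (iteration_step_solvable gamma Mt_gt0 Bt_gt0 J_diff A_bounded
      L_bounded J_bounded G_sym G_bounded G_coercive).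
  move=> u [_ uE].
  have contraction k :
      energy_norm G (u k.+1 - ubar) <= q gamma * energy_norm G (u k - ubar).
    (* The radicand of q may be negative when V0 is trivial; only G e e >= 0 is
       used to split the square root of the product. *)
    rewrite /energy_norm /q /rate mulrC -sqrtrM; last first.
      exact: coercive_ge0 Bt_gt0 G_coercive _.
    apply: ler_wsqrtr; rewrite mulrC.
    have -> : u k.+1 - ubar = (u k - ubar) + (u k.+1 - u k).
      by rewrite [RHS]addrC addrA subrK.
    apply: (energy_step_le Bt_gt0 G_coercive (r := residual A J L (u k))) => //.
    - exact: ltW.
    - by move=> v; rewrite linearBl /= uE; ring.
    - move=> v; have := residual_lipschitz L A_bounded J_lipschitz (u k) ubar v.
      by rewrite ubar_exact subr0.
    - have := residual_strongly_monotone L A_coercive J_monotone (u k) ubar.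
      by rewrite ubar_exact subr0.
    - exact/ltW/rate_gain_gt0.
  split=> //.
  apply: (energy_norm_contraction_cvg Bt_gt0 G_coercive (q := q gamma)) => //.
  by rewrite sqrtr_ge0 rate_lt1.
rewrite divr_gt0 ?mulr_gt0 ?exprn_gt0 //= ltr_pM2r ?invr_gt0 ?exprn_gt0 //.
by rewrite -mulrA ltr_pMl ?mulr_gt0 // ltr1n.
Qed.
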